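(* The coordinates $y_G,y_H,y_J$ are algebraic, with minimal polynomials $P_{y_G}=-912811377667500 + 16117998953248125 y^2 - 36709013218422600 y^4 + 37940201286814800 y^6 - 23463887481854208 y^8 + 10021184125203456 y^{10} - 3290335763447808 y^{12} + 888521341648896 y^{14} - 192809455583232 y^{16} + 29839017902080 y^{18} - 2742026240000 y^{20} + 109337116672 y^{22}$, $P_{y_H}=-12148787578527675 - 123412000423046805 y^2 - 441020584930952232 y^4 + 273168911377174014 y^6 - 27343071784237320 y^8 - 3667116898760364 y^{10} + 823044986987616 y^{12} - 32095868573376 y^{14} - 4779985142784 y^{16} + 615643279360 y^{18} - 27098808320 y^{20} + 427098112 y^{22}$, $P_{y_J}=-9964518750000 + 570277711828125 y^2 - 1780552966387500 y^4 + 849106838377800 y^6 + 644904447905880 y^8 - 102048280254828 y^{10} - 56106534718368 y^{12} + 9027433758528 y^{14} + 605520976896 y^{16} - 103349145600 y^{18} - 2815229952 y^{20} + 427098112 y^{22}$ respectively (each vanishes at the corresponding coordinate and is irreducible over $\mathbb Q$).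
   Context: Consider real numbers $t,T$ and points $A=(0,0)$, $B=(t,T)$, $C=(2t,0)$ and $P=(x_P,y_P)$ for $P\in\{D,E,F,G,H,J\}$ satisfying the system $t^2+T^2=1$; $-t(x_D-2t)+T y_D=\tfrac32$; $(x_D-2t)^2+y_D^2=9$; $t(x_E-t)-T(y_E-T)+1=0$; $(x_E-t)^2+(y_E-T)^2=4$; $x_F^2+y_F^2=1$; $|E-F|^2=1$; $|F-G|^2=1$; $|D-G|^2=4$; $|D-H|^2=4$; $|G-H|^2=4$; $|F-J|^2=1$; $|G-J|^2=1$; $x_H=x_J$. Fix the real solution with $t\approx0.992685948824186$, $T\approx0.120725337054926$, $D\approx(0.809996600722107,\,2.760161754567202)$, $E\approx(0.209102417540010,\,1.960833173433061)$, $F\approx(-0.061398137844065,\,0.998113354619244)$, $G\approx(-0.838419516770942,\,1.627587561152422)$, $H\approx(-0.995049481192288,\,3.621444891616507)$, $J\approx(-0.995049481192288,\,0.639930204451542)$. These points are the essential vertices of one quarter of the Harborth graph (a 4-regular planar unit-distance graph). *)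

(* Defs.v *)
From mathcomp Require Import all_boot all_order all_algebra.
From mathcomp Require Import reals.

Set Implicit Arguments.
Unset Strict Implicit.
Unset Printing Implicit Defensive.

Import Order.TTheory GRing.Theory Num.Theory.
Local Open Scope ring_scope.

Definition sqdist (R : realType) (P Q : R * R) : R :=
  (P.1 - Q.1) ^+ 2 + (P.2 - Q.2) ^+ 2.

(* The remaining essential vertices are A = (0, 0), B = (t, T), C = (2t, 0);
   they enter the system only through t and T. *)
Record harborth_system (R : realType) (t T : R) (D E F G H J : R * R) : Prop :=
  HarborthSystem {
    eq_tT : t ^+ 2 + T ^+ 2 = 1;
    eq_D : - t * (D.1 - 2 * t) + T * D.2 = 3 / 2;
    eq_CD : (D.1 - 2 * t) ^+ 2 + D.2 ^+ 2 = 9;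
    eq_E : t * (E.1 - t) - T * (E.2 - T) + 1 = 0;
    eq_BE : (E.1 - t) ^+ 2 + (E.2 - T) ^+ 2 = 4;
    eq_AF : F.1 ^+ 2 + F.2 ^+ 2 = 1;
    eq_EF : sqdist E F = 1;
    eq_FG : sqdist F G = 1;
    eq_DG : sqdist D G = 4;
    eq_DH : sqdist D H = 4;
    eq_GH : sqdist G H = 4;
    eq_FJ : sqdist F J = 1;
    eq_GJ : sqdist G J = 1;
    eq_HJ : H.1 = J.1
  }.

(* x ~ c * 10^-15, correctly rounded to the 15th decimal. *)
Definition approx15 (R : realType) (x c : R) : Prop :=
  `|x - c / 10 ^+ 15| <= 2^-1 / 10 ^+ 15.

(* Numerals of the form c%:R go through nat_scope, where large ones are kept as
   unevaluated decimals; a bare numeral in ring_scope would be expanded in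
   unary. *)
Record harborth_approx (R : realType) (t T : R) (D E F G H J : R * R) : Prop :=
  HarborthApprox {
    approx_t : approx15 t 992685948824186%:R;
    approx_T : approx15 T 120725337054926%:R;
    approx_xD : approx15 D.1 809996600722107%:R;
    approx_yD : approx15 D.2 2760161754567202%:R;
    approx_xE : approx15 E.1 209102417540010%:R;
    approx_yE : approx15 E.2 1960833173433061%:R;
    approx_xF : approx15 F.1 (- 61398137844065%:R);
    approx_yF : approx15 F.2 998113354619244%:R;
    approx_xG : approx15 G.1 (- 838419516770942%:R);
    approx_yG : approx15 G.2 1627587561152422%:R;
    approx_xH : approx15 H.1 (- 995049481192288%:R);
    approx_yH : approx15 H.2 3621444891616507%:R;
    approx_xJ : approx15 J.1 (- 995049481192288%:R);
    approx_yJ : approx15 J.2 639930204451542%:R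
  }.

Definition P_yG : {poly rat} :=
  - 912811377667500%:R *: 'X^0 + 16117998953248125%:R *: 'X^2
  - 36709013218422600%:R *: 'X^4 + 37940201286814800%:R *: 'X^6
  - 23463887481854208%:R *: 'X^8 + 10021184125203456%:R *: 'X^10
  - 3290335763447808%:R *: 'X^12 + 888521341648896%:R *: 'X^14
  - 192809455583232%:R *: 'X^16 + 29839017902080%:R *: 'X^18
  - 2742026240000%:R *: 'X^20 + 109337116672%:R *: 'X^22.

Definition P_yH : {poly rat} :=
  - 12148787578527675%:R *: 'X^0 - 123412000423046805%:R *: 'X^2
  - 441020584930952232%:R *: 'X^4 + 273168911377174014%:R *: 'X^6
  - 27343071784237320%:R *: 'X^8 - 3667116898760364%:R *: 'X^10
  + 823044986987616%:R *: 'X^12 - 32095868573376%:R *: 'X^14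
  - 4779985142784%:R *: 'X^16 + 615643279360%:R *: 'X^18
  - 27098808320%:R *: 'X^20 + 427098112%:R *: 'X^22.

Definition P_yJ : {poly rat} :=
  - 9964518750000%:R *: 'X^0 + 570277711828125%:R *: 'X^2
  - 1780552966387500%:R *: 'X^4 + 849106838377800%:R *: 'X^6
  + 644904447905880%:R *: 'X^8 - 102048280254828%:R *: 'X^10
  - 56106534718368%:R *: 'X^12 + 9027433758528%:R *: 'X^14
  + 605520976896%:R *: 'X^16 - 103349145600%:R *: 'X^18
  - 2815229952%:R *: 'X^20 + 427098112%:R *: 'X^22.

(* A minimal polynomial over Q, up to a nonzero constant factor: the
   polynomials above have integer coefficients and are not monic. *)
Definition minimal_poly_over_Q (R : realType) (p : {poly rat}) (y : R) : Prop :=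
  root (map_poly ratr p) y /\ irreducible_poly p.

(* Main.v *)
(* The coordinates of the configuration lie in an explicit field: w = 12 T^2 is
   a root of a polynomial of degree 11 with small integer coefficients, and all
   abscissas (ordinates) are sqrt 3 * T (resp. T) times elements of Q(w).  Hence
   an exact solution close to the given one is obtained by taking the root w
   supplied by the intermediate value theorem, and each equation of the system,
   as well as the vanishing of the three polynomials, is a congruence modulo the
   polynomial of w.  The given solution equals this exact one, because the
   difference of two nearby solutions of a quadratic system is annihilated by
   the Jacobian at their midpoint, which is close to a fixed invertible matrix.
   Irreducibility over Q holds because all three polynomials stay irreducible
   modulo 31: their roots in extensions of F_31 of degree k <= 11 would satisfy
   x^(31^k) = x, and each polynomial is coprime to all X^(31^k) - X. *)
Require Import Defs.
From Stdlib Require Import ZArith.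
From mathcomp Require Import all_boot all_order all_algebra all_field.
From mathcomp Require Import reals zify ssrZ ring lra.
From mathcomp.algebra_tactics Require common.

Set Implicit Arguments.
Unset Strict Implicit.
Unset Printing Implicit Defensive.

Import Order.TTheory GRing.Theory Num.Theory.
Local Open Scope ring_scope.
Local Delimit Scope Z_scope with coqZ.

(** * Integer polynomials as lists *)

(** Coefficients stay in binary [Z], so that all checks run by [vm_compute]; the target ring varies
    because the same lists are read over [rat], over extensions of F_p and over the reals. *)
Definition zr (K : comNzRingType) (c : Z) : K := (int_of_Z c)%:~R.

Lemma zrD (K : comNzRingType) (a b : Z) : zr K (Z.add a b) = zr K a + zr K b.
Proof. by rewrite /zr -rmorphD -rmorphD. Qed.

Lemma zrM (K : comNzRingType) (a b : Z) : zr K (Z.mul a b) = zr K a * zr K b.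
Proof. by rewrite /zr -rmorphM -rmorphM. Qed.

Lemma zrN (K : comNzRingType) (a : Z) : zr K (Z.opp a) = - zr K a.
Proof. by rewrite /zr -rmorphN -rmorphN. Qed.

Lemma zr_nat (K : comNzRingType) (n : nat) : zr K (Z.of_nat n) = n%:R.
Proof. by case: n => //= n; rewrite /zr /= SuccNat2Pos.id_succ. Qed.

Fixpoint padd (a b : seq Z) : seq Z :=
  match a, b with
  | [::], _ => b
  | _, [::] => a
  | x :: a', y :: b' => Z.add x y :: padd a' b'
  end.

Definition pscale (c : Z) : seq Z -> seq Z := map (Z.mul c).

Definition psub (a b : seq Z) : seq Z := padd a (pscale (Zneg 1) b).

Definition pmul (a b : seq Z) : seq Z :=
  foldr (fun c acc => padd (pscale c b) (Z0 :: acc)) [::] a.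

Definition ptrim : seq Z -> seq Z :=
  foldr (fun c acc => if nilp acc && Z.eqb c Z0 then [::] else c :: acc) [::].

(* Subtracts multiples of [f] until the size drops below that of [f], with [n]
   as fuel; the quotient of the leading coefficients is rounded, so leading
   terms cancel only when it is exact. *)
Fixpoint prem_rec (n : nat) (f a : seq Z) : seq Z :=
  if n is n'.+1 then
    if (size a < size f)%N then a else
    let c := Z.div (last Z0 a) (last Z0 f) in
    prem_rec n' f (ptrim (psub a (pscale c (ncons (size a - size f) Z0 f))))
  else a.

Definition prem (f a : seq Z) : seq Z := let a' := ptrim a in prem_rec (size a') f a'.

Definition ev (K : comNzRingType) (a : seq Z) (x : K) : K :=
  foldr (fun c acc => zr K c + x * acc) 0 a.

Lemma ev_add (K : comNzRingType) (x : K) (a b : seq Z) :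
  ev (padd a b) x = ev a x + ev b x.
Proof.
elim: a b => [|c a IHa] [|d b] /=; rewrite ?add0r ?addr0 //.
by rewrite IHa zrD mulrDr addrACA.
Qed.

Lemma ev_scale (K : comNzRingType) (x : K) (c : Z) (a : seq Z) :
  ev (pscale c a) x = zr K c * ev a x.
Proof. by elim: a => [|d a IHa] /=; rewrite ?mulr0 // IHa zrM mulrDr mulrCA. Qed.

Lemma ev_sub (K : comNzRingType) (x : K) (a b : seq Z) :
  ev (psub a b) x = ev a x - ev b x.
Proof. by rewrite ev_add ev_scale -[Zneg 1]/(Z.opp (Zpos 1)) zrN mulN1r. Qed.

Lemma ev_mul (K : comNzRingType) (x : K) (a b : seq Z) :
  ev (pmul a b) x = ev a x * ev b x.
Proof.
elim: a => [|c a IHa] /=; first by rewrite mul0r.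
by rewrite ev_add ev_scale /= IHa add0r mulrDl mulrA.
Qed.

Lemma ev_trim (K : comNzRingType) (x : K) (a : seq Z) : ev (ptrim a) x = ev a x.
Proof.
elim: a => //= c a <-; case: ifP => //= /andP[/nilP -> /Z.eqb_eq ->].
by rewrite mulr0 addr0.
Qed.

Lemma ev_ncons0 (K : comNzRingType) (x : K) (n : nat) (a : seq Z) :
  ev (ncons n Z0 a) x = x ^+ n * ev a x.
Proof. by elim: n => [|n IHn] /=; rewrite ?mul1r // IHn add0r exprS mulrA. Qed.

(** Each round subtracts a multiple of [f], whatever the rounded quotient, so the value at a root of
    [f] survives even if the reduction stops early. *)
Lemma ev_rem (K : comNzRingType) (x : K) (f a : seq Z) :
  ev f x = 0 -> ev (prem f a) x = ev a x.
Proof.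
move=> fx0; rewrite -(ev_trim x a) /prem; set n := size _.
elim: n (ptrim a) => //= n IHn b; case: ifP => // _.
by rewrite IHn ev_trim ev_sub ev_scale ev_ncons0 fx0 !mulr0 subr0.
Qed.

Lemma evE (K : comNzRingType) (x : K) (a : seq Z) :
  ev a x = (Poly [seq zr K c | c <- a]).[x].
Proof. by elim: a => [|c a IHa] /=; rewrite ?horner0 // horner_cons -IHa addrC mulrC. Qed.

Lemma zr_rmorph (K K' : comNzRingType) (h : {rmorphism K -> K'}) (c : Z) :
  h (zr K c) = zr K' c.
Proof. by rewrite /zr rmorph_int. Qed.

Lemma map_poly_zr (K K' : comNzRingType) (h : {rmorphism K -> K'}) (a : seq Z) :
  map_poly h (Poly [seq zr K c | c <- a]) = Poly [seq zr K' c | c <- a].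
Proof.
by rewrite map_Poly -map_comp; congr Poly; apply: eq_map => c /=; rewrite zr_rmorph.
Qed.

(** This is g(X^2); trimming drops the zero that the interleaving leaves at the top, so that [last]
    gives the leading coefficient. *)
Definition pexpand2 (g : seq Z) : seq Z :=
  ptrim (foldr (fun c acc => c :: Z0 :: acc) [::] g).

Lemma ev_expand2 (K : comNzRingType) (x : K) (g : seq Z) :
  ev (pexpand2 g) x = ev g (x ^+ 2).
Proof.
rewrite ev_trim; elim: g => //= c g ->.
by rewrite {1}/zr /= add0r mulrA -expr2.
Qed.

(** * Irreducibility modulo a prime *)

Definition pmod (m : Z) (a : seq Z) : seq Z := ptrim [seq Z.modulo c m | c <- a].

Definition mulmod (m : Z) (f a b : seq Z) : seq Z := pmod m (prem f (pmul a b)).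

Definition frob (p : nat) (f h : seq Z) : seq Z :=
  iter p.-1 (mulmod (Z.of_nat p) f h) h.

(* Multiplies [acc] by the [h^(p^j) - X] for [1 <= j <= k], modulo [f] and [p]. *)
Fixpoint frob_prod (p k : nat) (f h acc : seq Z) : seq Z :=
  if k is k'.+1 then
    let h' := frob p f h in
    frob_prod p k' f h' (mulmod (Z.of_nat p) f acc (psub h' [:: Z0; Zpos 1]))
  else acc.

Lemma zr_mod (K : comNzRingType) (p : nat) (c : Z) :
  (0 < p)%N -> p%:R = 0 :> K -> zr K (Z.modulo c (Z.of_nat p)) = zr K c.
Proof.
move=> p_gt0 p0; have pz : Z.of_nat p <> Z0 by case: p p_gt0 {p0}.
by rewrite {2}(Z.div_mod c _ pz) zrD zrM zr_nat p0 mul0r add0r.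
Qed.

Lemma ev_pmod (K : comNzRingType) (p : nat) (x : K) (a : seq Z) :
  (0 < p)%N -> p%:R = 0 :> K -> ev (pmod (Z.of_nat p) a) x = ev a x.
Proof.
by move=> p_gt0 p0; rewrite ev_trim; elim: a => //= c a ->; rewrite zr_mod.
Qed.

Lemma ev_mulmod (K : comNzRingType) (p : nat) (f a b : seq Z) (x : K) :
    (0 < p)%N -> p%:R = 0 :> K -> ev f x = 0 ->
  ev (mulmod (Z.of_nat p) f a b) x = ev a x * ev b x.
Proof. by move=> p_gt0 p0 fx0; rewrite ev_pmod // ev_rem // ev_mul. Qed.

Lemma ev_frob (K : comNzRingType) (p : nat) (f h : seq Z) (x : K) :
    (0 < p)%N -> p%:R = 0 :> K -> ev f x = 0 ->
  ev (frob p f h) x = ev h x ^+ p.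
Proof.
move=> p_gt0 p0 fx0; rewrite -{2}(prednK p_gt0) exprSr /frob.
by elim: p.-1 => [|n IHn]; rewrite ?mul1r //= ev_mulmod // IHn exprS mulrA.
Qed.

(** The [d]-th factor vanishes at [x], and the accumulator stays zero there afterwards. The
    induction replaces [h] by h^p and lowers [d] by one. *)
Lemma ev_frob_prod (K : comNzRingType) (p d k : nat) (f h acc : seq Z) (x : K) :
    (0 < p)%N -> p%:R = 0 :> K -> ev f x = 0 ->
    (0 < d <= k)%N -> ev h x ^+ (p ^ d) = x ->
  ev (frob_prod p k f h acc) x = 0.
Proof.
move=> p_gt0 p0 fx0.
suff acc0 n h' acc' : ev acc' x = 0 -> ev (frob_prod p n f h' acc') x = 0.
  elim: k d h acc => [|k IHk] [|d] h acc //= ledk hd.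
  case: d ledk hd => [_|d ledk hd].
    rewrite expn1 => hx; apply: acc0; rewrite ev_mulmod // ev_sub ev_frob // hx /=.
    by rewrite /zr /= mulr0 addr0 mulr1 add0r subrr mulr0.
  by apply: (IHk d.+1); rewrite // ev_frob // -exprM -expnS.
elim: n h' acc' => //= n IHn h' acc' acc0.
by apply: IHn; rewrite ev_mulmod // acc0 mul0r.
Qed.

(** A root [x] of [q] in a splitting field generates an extension of degree d <= deg q, because its
    minimal polynomial divides [q]; Fermat's little theorem in that finite field gives the last
    claim. *)
Lemma root_Frobenius (F : finFieldType) (q : {poly F}) : (1 < size q)%N ->
  exists (L : fieldExtType F) (x : L) (d : nat),
    [/\ root (map_poly (in_alg L) q) x, (0 < d < size q)%N & x ^+ (#|F| ^ d) = x].
Proof.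
move=> q1; have q0 : q != 0 by rewrite -size_poly_gt0 ltnW.
have [L [rs Dq _]] := FinSplittingFieldFor q0.
case: rs => [|x rs] in Dq.
  by move/eqp_size: Dq; rewrite big_nil size_poly1 size_map_poly => sq; rewrite sq in q1.
have qx : root (map_poly (in_alg L) q) x.
  by rewrite (eqp_root Dq) root_prod_XsubC mem_head.
have dq : (adjoin_degree 1%AS x < size q)%N.
  rewrite -size_minPoly -(size_map_poly (in_alg L) q) dvdp_leq ?map_poly_eq0 //.
  by rewrite minPoly_dvdp // alg_polyOver.
exists L, x, (adjoin_degree 1%AS x); split; rewrite ?dq //.
apply/eqP; have := Fermat's_little_theorem <<1; x>>%AS x.
by rewrite memv_adjoin dim_Fadjoin dimv1 muln1 => <-.
Qed.

(* A certificate for [irreducible_modP]: [f] has unit leading coefficient mod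
   [p], [c * f] is monic mod [p], and [g] inverts mod [(p, f)] the product of
   the [X^(p^j) - X] with [j] at most half the degree of [f], which vanishes at
   every root of degree at most [j] over F_p. *)
Definition irreducible_cert (p : nat) (f : seq Z) (c : Z) (g : seq Z) : bool :=
  let q := Z.of_nat p in
  let f' := pmod q (pscale c f) in
  let h := frob_prod p (size f).-1./2 f' [:: Z0; Zpos 1] [:: Zpos 1] in
  ~~ Z.eqb (Z.modulo (last Z0 f) q) Z0 && (mulmod q f' g h == [:: Zpos 1]).

Lemma zr_Fp_eq0 (p : nat) (c : Z) : prime p ->
  zr 'F_p c = 0 -> Z.modulo c (Z.of_nat p) = Z0.
Proof.
move=> p_pr; have p_gt0 := prime_gt0 p_pr.
have pz : Z.lt Z0 (Z.of_nat p) by case: p p_gt0 {p_pr}.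
rewrite -(zr_mod c p_gt0 (pchar_Fp_0 p_pr)).
have [c_ge0 c_lt] := Z.mod_pos_bound c _ pz.
rewrite -(Z2Nat.id _ c_ge0) zr_nat => /eqP.
rewrite -(dvdn_pcharf (pchar_Fp p_pr)) => p_dv.
move: c_lt; rewrite -(Z2Nat.id _ c_ge0) -Nat2Z.inj_lt => /ssrnat.ltP c_lt.
case: (posnP (Z.to_nat (Z.modulo c (Z.of_nat p)))) => [-> //|c_gt0].
by have := leq_trans c_lt (dvdn_leq c_gt0 p_dv); rewrite ltnn.
Qed.

(** A nonconstant factor of degree at most half that of [f] would have a root where [f] and the
    product of the X^(p^j) - X both vanish; there the certificate would read 0 = 1. *)
Lemma irreducible_cert_no_factor (p : nat) (f : seq Z) (c : Z) (g : seq Z)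
    (q : {poly 'F_p}) :
    prime p -> irreducible_cert p f c g -> q %| Poly [seq zr 'F_p a | a <- f] ->
  (1 < size q)%N -> ((size f).-1./2.+1 < size q)%N.
Proof.
move=> p_pr /andP[_ /eqP inv_g] q_dv q1; rewrite ltnNge; apply/negP => q_small.
have p_gt0 := prime_gt0 p_pr.
have [L [x [d [qx /andP[d0 dq] xd]]]] := root_Frobenius q1.
have p0 : p%:R = 0 :> L.
  by rewrite -(rmorph_nat (in_alg L)) pchar_Fp_0 ?rmorph0.
have fx : ev f x = 0.
  rewrite evE -(map_poly_zr (in_alg L)); apply/rootP.
  by apply: root_dvdp qx; rewrite dvdp_map.
have f'x : ev (pmod (Z.of_nat p) (pscale c f)) x = 0.
  by rewrite ev_pmod // ev_scale fx mulr0.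
have /(congr1 (fun a => ev a x)) := inv_g.
rewrite ev_mulmod // (ev_frob_prod _ p_gt0 p0 f'x (d := d)).
- by rewrite /= /zr !mulr0 addr0 => /esym/eqP; rewrite oner_eq0.
- by rewrite d0 -ltnS (leq_trans dq).
- by rewrite /= /zr /= !mulr0 !addr0 mulr1 add0r -{2}xd card_Fp.
Qed.

(** Since the leading coefficient survives modulo [p], a factorization over Z reduces to one with
    the same degrees, and two nonconstant factors cannot both exceed half the degree. *)
Lemma irreducible_modP (p : nat) (f : seq Z) (c : Z) (g : seq Z) :
    prime p -> (1 < size f)%N -> irreducible_cert p f c g ->
  irreducible_poly (Poly [seq zr rat a | a <- f]).
Proof.
move=> p_pr f1 cert_f; have no_factor q := irreducible_cert_no_factor (q := q) p_pr cert_f.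
pose fZ := Poly [seq zr int a | a <- f].
have -> : Poly [seq zr rat a | a <- f] = map_poly intr fZ by rewrite map_poly_zr.
pose toFp := map_poly (intr : int -> 'F_p).
have fZ_Fp : toFp fZ = Poly [seq zr 'F_p a | a <- f] by rewrite /toFp map_poly_zr.
have lead_f : zr 'F_p (last Z0 f) != 0.
  by case/andP: cert_f => /Z.eqb_spec lead_f _; apply/eqP => /(zr_Fp_eq0 p_pr).
have size_Fp : size (toFp fZ) = size f.
  by rewrite fZ_Fp (@PolyK _ 0) ?size_map // (last_map (zr 'F_p) f Z0).
have size_Z : size fZ = size f.
  apply/eqP; rewrite eqn_leq -{2}size_Fp size_poly /=.
  by rewrite (leq_trans (size_Poly _)) ?size_map.
apply/irreducible_rat_int; split=> [|q q1 q_dv]; first by rewrite size_Z.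
rewrite -Pdiv.Idomain.dvdp_size_eqp //.
(* Gauss's lemma: the primitive part of [q] divides already over Z, so the factorization can be
   reduced modulo [p]. *)
have [r Dr] := dvdpP_int q_dv.
have Dr_Fp : toFp fZ = toFp (zprimitive q) * toFp r by rewrite {1}Dr /toFp rmorphM.
have : toFp fZ != 0 by rewrite -size_poly_gt0 size_Fp ltnW.
rewrite Dr_Fp mulf_eq0 negb_or => /andP[q'_neq0 r_neq0].
have q'_leq : (size (toFp (zprimitive q)) <= size q)%N.
  by rewrite -(size_zprimitive q) size_poly.
have r_leq : (size (toFp r) <= size r)%N by apply: size_poly.
have /no_factor : toFp (zprimitive q) %| Poly [seq zr 'F_p a | a <- f].
  by rewrite -fZ_Fp Dr_Fp dvdp_mulr.
have /no_factor : toFp r %| Poly [seq zr 'F_p a | a <- f].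
  by rewrite -fZ_Fp Dr_Fp dvdp_mull.
move: q'_neq0 r_neq0; rewrite -!size_poly_gt0 => q'_gt0 r_gt0.
have r_gt0' := leq_trans r_gt0 r_leq; have q_gt0 := leq_trans q'_gt0 q'_leq.
have := size_Fp; rewrite Dr_Fp size_mul -?size_poly_gt0 //.
have : (size (zprimitive q * r)).-1 = (size f).-1 by rewrite -Dr size_Z.
rewrite size_mul -?size_poly_gt0 ?size_zprimitive // size_Z.
move: q1 f1 q'_leq r_leq q'_gt0 r_gt0 r_gt0' q_gt0.
move: (size q) (size r) (size (toFp r)) (size f) (size (toFp _)) => sq sr b n a.
(* The degree n - 1 is 2k or 2k + 1, while two nonconstant factors would have degrees summing to at
   least 2k + 2. *)
have := odd_double_half n.-1; move: n.-1./2 (odd _) => k [] /=; rewrite -addnn;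
  case: (ltnP 1 a) => la; case: (ltnP 1 b) => lb; lia.
Qed.

(** * The three polynomials and their irreducibility *)

Definition unquad (s : seq (Z * Z * Z * Z)) : seq Z :=
  flatten [seq [:: t.1.1.1; t.1.1.2; t.1.2; t.2] | t <- s].

(* The coefficients of the polynomials in y^2, grouped for [phom4]. *)
Definition yG_sq : seq (Z * Z * Z * Z) := [:: (-912811377667500, 16117998953248125,
  -36709013218422600, 37940201286814800); (-23463887481854208, 10021184125203456,
  -3290335763447808, 888521341648896); (-192809455583232, 29839017902080,
  -2742026240000, 109337116672)]%coqZ.

Definition yH_sq : seq (Z * Z * Z * Z) := [:: (-12148787578527675,
  -123412000423046805, -441020584930952232, 273168911377174014);
  (-27343071784237320, -3667116898760364, 823044986987616, -32095868573376);
  (-4779985142784, 615643279360, -27098808320, 427098112)]%coqZ.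

Definition yJ_sq : seq (Z * Z * Z * Z) := [:: (-9964518750000, 570277711828125,
  -1780552966387500, 849106838377800); (644904447905880, -102048280254828,
  -56106534718368, 9027433758528); (605520976896, -103349145600, -2815229952,
  427098112)]%coqZ.

(** Connects decimal numerals with binary [Z] by way of [N], never expanding them in unary. *)
Lemma zr_uint (K : comNzRingType) (d : Decimal.uint) :
  (Nat.of_num_uint (Number.UIntDecimal d))%:R =
  zr K (Z.of_num_uint (Number.UIntDecimal d)).
Proof. by rewrite /= -common.uint_N_nat /Z.of_uint /N.of_uint; case: (BinPos.Pos.of_uint d). Qed.

Lemma zr_neg (K : comNzRingType) (c : positive) : zr K (Zneg c) = - zr K (Zpos c).
Proof. exact: (zrN K (Zpos c)). Qed.

(* Every numeral is generalized before the ring reasoning: a conversion test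
   between two of them would expand them in unary. *)
Ltac generalize_numerals :=
  repeat match goal with |- context [@zr ?K (Zneg ?c)] =>
    generalize (@zr_neg K c); generalize (@zr K (Zneg c)); intros ? ->
  end;
  repeat match goal with |- context [@zr ?K Z0] =>
    generalize (erefl : @zr K Z0 = 0); generalize (@zr K Z0); intros ? ->
  end;
  repeat match goal with |- context [@zr ?K (Zpos ?c)] =>
    match goal with |- context [Nat.of_num_uint (Number.UIntDecimal ?d)] =>
      let z := eval vm_compute in (Z.of_num_uint (Number.UIntDecimal d)) in
      constr_eq z (Zpos c);
      generalize (@zr_uint K d : _ = @zr K (Zpos c));
      generalize (Nat.of_num_uint (Number.UIntDecimal d));
      generalize (@zr K (Zpos c)); intros ? ? <-
    end
  end.

Lemma P_yG_list : P_yG = Poly [seq zr rat a | a <- pexpand2 (unquad yG_sq)].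
Proof.
rewrite /P_yG; set a := pexpand2 _; vm_compute in a; subst a; unfold map.
generalize_numerals.
by rewrite /Poly /foldr !cons_poly_def -!mul_polyC; ring.
Qed.

Lemma P_yG_irreducible : irreducible_poly P_yG.
Proof.
(* 18 inverts the leading coefficient modulo 31. The polynomial is even and the eleven factors
   X^(31^j) - X are odd, so the inverse of their product is odd: X times a polynomial in X^2. *)
rewrite P_yG_list; apply: (@irreducible_modP 31 _ 18
  (Z0 :: pexpand2 [:: 10; 1; 28; 8; 27; 14; 17; 15; 24; 6; 18]%coqZ)); [by [] | by [] |].
by vm_compute.
Qed.

Lemma P_yH_list : P_yH = Poly [seq zr rat a | a <- pexpand2 (unquad yH_sq)].
Proof.
rewrite /P_yH; set a := pexpand2 _; vm_compute in a; subst a; unfold map.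
generalize_numerals.
by rewrite /Poly /foldr !cons_poly_def -!mul_polyC; ring.
Qed.

Lemma P_yH_irreducible : irreducible_poly P_yH.
Proof.
(* 20 inverts 427098112 modulo 31, the leading coefficient of both [P_yH] and [P_yJ]. *)
rewrite P_yH_list; apply: (@irreducible_modP 31 _ 20
  (Z0 :: pexpand2 [:: 28; 9; 14; 24; 24; 0; 8; 14; 25; 17; 6]%coqZ)); [by [] | by [] |].
by vm_compute.
Qed.

Lemma P_yJ_list : P_yJ = Poly [seq zr rat a | a <- pexpand2 (unquad yJ_sq)].
Proof.
rewrite /P_yJ; set a := pexpand2 _; vm_compute in a; subst a; unfold map.
generalize_numerals.
by rewrite /Poly /foldr !cons_poly_def -!mul_polyC; ring.
Qed.

Lemma P_yJ_irreducible : irreducible_poly P_yJ.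
Proof.
rewrite P_yJ_list; apply: (@irreducible_modP 31 _ 20
  (Z0 :: pexpand2 [:: 13; 23; 3; 5; 24; 8; 16; 3; 15; 22; 12]%coqZ)); [by [] | by [] |].
by vm_compute.
Qed.

(** * Local uniqueness of the configuration *)

Lemma le_sum_norm (R : numDomainType) (s : seq R) (d : R) :
  d \in s -> `|d| <= \sum_(x <- s) `|x|.
Proof.
by move=> sd; rewrite (big_rem d sd) lerDl sumr_ge0.
Qed.

(* The rows are the rounded rows of 10^5 times the Jacobian of the system at the
   approximate solution, and [24 * S] bounds the rounding and second order
   errors.  Eliminating one vertex after the other writes each difference as a
   multiple of [dT] up to a small multiple of [S]; since the multiples for [dxH]
   and [dxJ] differ, the last equation forces [dT] itself to be small. *)
Lemma linearized_rigid (R : realFieldType)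
    (dt dT dxD dyD dxE dyE dxF dyF dxG dyG dxH dyH dxJ dyJ : R)
    (S := \sum_(d <- [:: dt; dT; dxD; dyD; dxE; dyE; dxF; dyF;
                        dxG; dyG; dxH; dyH; dxJ; dyJ]) `|d|) :
  `|198538%:R * dt + 24146%:R * dT| <= 24 * S ->
  `|- 99269%:R * dxD + 316076%:R * dt + 12073%:R * dyD + 276016%:R * dT| <= 24 * S ->
  `|- 235076%:R * dxD + 470152%:R * dt + 552032%:R * dyD| <= 24 * S ->
  `|99269%:R * dxE - 177628%:R * dt - 12073%:R * dyE - 171937%:R * dT| <= 24 * S ->
  `|- 156718%:R * dxE + 156718%:R * dt + 368020%:R * dyE - 368020%:R * dT| <= 24 * S ->
  `|- 12280%:R * dxF + 199622%:R * dyF| <= 24 * S ->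
  `|54100%:R * dxE - 54100%:R * dxF + 192544%:R * dyE - 192544%:R * dyF| <= 24 * S ->
  `|155404%:R * dxF - 155404%:R * dxG - 125896%:R * dyF + 125896%:R * dyG| <= 24 * S ->
  `|329684%:R * dxD - 329684%:R * dxG + 226514%:R * dyD - 226514%:R * dyG| <= 24 * S ->
  `|361010%:R * dxD - 361010%:R * dxH - 172256%:R * dyD + 172256%:R * dyH| <= 24 * S ->
  `|31326%:R * dxG - 31326%:R * dxH - 398770%:R * dyG + 398770%:R * dyH| <= 24 * S ->
  `|186730%:R * dxF - 186730%:R * dxJ + 71636%:R * dyF - 71636%:R * dyJ| <= 24 * S ->
  `|31326%:R * dxG - 31326%:R * dxJ + 197532%:R * dyG - 197532%:R * dyJ| <= 24 * S ->
  dxH = dxJ -> S = 0.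
Proof.
have S_ge0 : 0 <= S by apply: sumr_ge0 => d _; apply: normr_ge0.
have /ler_normlP[dT1 dT2] : `|dT| <= S by apply: le_sum_norm; rewrite !inE eqxx orbT.
have := erefl S; rewrite {2}/S !big_cons big_nil => defS.
move: S S_ge0 dT1 dT2 defS => S S_ge0 dT1 dT2 defS.
move=> /ler_normlP[a0 b0] /ler_normlP[a1 b1] /ler_normlP[a2 b2] /ler_normlP[a3 b3]
  /ler_normlP[a4 b4] /ler_normlP[a5 b5] /ler_normlP[a6 b6] /ler_normlP[a7 b7]
  /ler_normlP[a8 b8] /ler_normlP[a9 b9] /ler_normlP[a10 b10] /ler_normlP[a11 b11]
  /ler_normlP[a12 b12] eqHJ.
(* Here and below, the multiple of [dT] approximates the derivative of the coordinate with respect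
   to T along the curve cut out by the first thirteen equations; [|dT| <= S] absorbs the
   rounding. *)
have /ler_normlP[lt ut] :
    `|dt + 12200%:R / 100000%:R * dT| <= 6000%:R / 10000000%:R * S.
  by clear -S_ge0 dT1 dT2 a0 b0; apply/ler_normlP; split; lra.
have /ler_normlP[lxD uxD] :
    `|dxD - 253600%:R / 100000%:R * dT| <= 23000%:R / 10000000%:R * S.
  by clear -S_ge0 dT1 dT2 a1 b1 a2 b2 lt ut; apply/ler_normlP; split; lra.
have /ler_normlP[lyD uyD] :
    `|dyD - 118400%:R / 100000%:R * dT| <= 7000%:R / 10000000%:R * S.
  by clear -S_ge0 dT1 dT2 a1 b1 a2 b2 lt ut; apply/ler_normlP; split; lra.
have /ler_normlP[lxE uxE] :
    `|dxE - 173100%:R / 100000%:R * dT| <= 17000%:R / 10000000%:R * S.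
  by clear -S_ge0 dT1 dT2 a3 b3 a4 b4 lt ut; apply/ler_normlP; split; lra.
have /ler_normlP[lyE uyE] :
    `|dyE - 178900%:R / 100000%:R * dT| <= 7000%:R / 10000000%:R * S.
  by clear -S_ge0 dT1 dT2 a3 b3 a4 b4 lt ut; apply/ler_normlP; split; lra.
have /ler_normlP[lxF uxF] :
    `|dxF - 664400%:R / 100000%:R * dT| <= 46000%:R / 10000000%:R * S.
  by clear -S_ge0 dT1 dT2 a5 b5 a6 b6 lxE uxE lyE uyE; apply/ler_normlP; split; lra.
have /ler_normlP[lyF uyF] :
    `|dyF - 40900%:R / 100000%:R * dT| <= 7000%:R / 10000000%:R * S.
  by clear -S_ge0 dT1 dT2 a5 b5 a6 b6 lxE uxE lyE uyE; apply/ler_normlP; split; lra.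
have /ler_normlP[lxG uxG] :
    `|dxG - 470900%:R / 100000%:R * dT| <= 43000%:R / 10000000%:R * S.
    by clear -S_ge0 dT1 dT2 a7 b7 a8 b8 lxD uxD lyD uyD lxF uxF lyF uyF;
    apply/ler_normlP; split; lra.
have /ler_normlP[lyG uyG] :
    `|dyG + 197900%:R / 100000%:R * dT| <= 57000%:R / 10000000%:R * S.
    by clear -S_ge0 dT1 dT2 a7 b7 a8 b8 lxD uxD lyD uyD lxF uxF lyF uyF;
    apply/ler_normlP; split; lra.
have /ler_normlP[lxH uxH] :
    `|dxH - 88300%:R / 100000%:R * dT| <= 63000%:R / 10000000%:R * S.
    by clear -S_ge0 dT1 dT2 a9 b9 a10 b10 lxD uxD lyD uyD lxG uxG lyG uyG;
    apply/ler_normlP; split; lra.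
have /ler_normlP[lyH uyH] :
    `|dyH + 228000%:R / 100000%:R * dT| <= 71000%:R / 10000000%:R * S.
    by clear -S_ge0 dT1 dT2 a9 b9 a10 b10 lxD uxD lyD uyD lxG uxG lyG uyG;
    apply/ler_normlP; split; lra.
have /ler_normlP[lxJ uxJ] :
    `|dxJ - 774500%:R / 100000%:R * dT| <= 82000%:R / 10000000%:R * S.
    by clear -S_ge0 dT1 dT2 a11 b11 a12 b12 lxF uxF lyF uyF lxG uxG lyG uyG;
    apply/ler_normlP; split; lra.
have /ler_normlP[lyJ uyJ] :
    `|dyJ + 246000%:R / 100000%:R * dT| <= 83000%:R / 10000000%:R * S.
    by clear -S_ge0 dT1 dT2 a11 b11 a12 b12 lxF uxF lyF uyF lxG uxG lyG uyG;
    apply/ler_normlP; split; lra.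
(* The slopes 0.883 of [dxH] and 7.745 of [dxJ] give 6.862 * |dT| <= 0.0145 * S. *)
have bT : `|dT| <= 22000%:R / 10000000%:R * S.
  by clear -S_ge0 dT1 dT2 eqHJ lxH uxH lxJ uxJ; apply/ler_normlP; split; lra.
have /ler_normlP[lT uT] := bT.
have bt : `|dt| <= 9000%:R / 10000000%:R * S.
  by clear -S_ge0 lt ut lT uT; apply/ler_normlP; split; lra.
have bxD : `|dxD| <= 79000%:R / 10000000%:R * S.
  by clear -S_ge0 lxD uxD lT uT; apply/ler_normlP; split; lra.
have byD : `|dyD| <= 34000%:R / 10000000%:R * S.
  by clear -S_ge0 lyD uyD lT uT; apply/ler_normlP; split; lra.
have bxE : `|dxE| <= 56000%:R / 10000000%:R * S.
  by clear -S_ge0 lxE uxE lT uT; apply/ler_normlP; split; lra.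
have byE : `|dyE| <= 47000%:R / 10000000%:R * S.
  by clear -S_ge0 lyE uyE lT uT; apply/ler_normlP; split; lra.
have bxF : `|dxF| <= 193000%:R / 10000000%:R * S.
  by clear -S_ge0 lxF uxF lT uT; apply/ler_normlP; split; lra.
have byF : `|dyF| <= 16000%:R / 10000000%:R * S.
  by clear -S_ge0 lyF uyF lT uT; apply/ler_normlP; split; lra.
have bxG : `|dxG| <= 147000%:R / 10000000%:R * S.
  by clear -S_ge0 lxG uxG lT uT; apply/ler_normlP; split; lra.
have byG : `|dyG| <= 101000%:R / 10000000%:R * S.
  by clear -S_ge0 lyG uyG lT uT; apply/ler_normlP; split; lra.
have bxH : `|dxH| <= 83000%:R / 10000000%:R * S.
  by clear -S_ge0 lxH uxH lT uT; apply/ler_normlP; split; lra.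
have byH : `|dyH| <= 122000%:R / 10000000%:R * S.
  by clear -S_ge0 lyH uyH lT uT; apply/ler_normlP; split; lra.
have bxJ : `|dxJ| <= 253000%:R / 10000000%:R * S.
  by clear -S_ge0 lxJ uxJ lT uT; apply/ler_normlP; split; lra.
have byJ : `|dyJ| <= 138000%:R / 10000000%:R * S.
  by clear -S_ge0 lyJ uyJ lT uT; apply/ler_normlP; split; lra.
(* The fourteen bounds add up to S <= 0.13 * S. *)
by clear -S_ge0 defS bt bT bxD byD bxE byE bxF byF bxG byG bxH byH bxJ byJ; lra.
Qed.

(** The radius 3/5 leaves some slack over the rounding error 1/2, and is below 2/3, so that even xD
    - 2t, scaled by 10^5, is within 2 of its center, as [bilinear_diff] requires. *)
Definition near1 (R : realType) (x c : R) : Prop :=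
  `|100000%:R * x - c| <= 3 / 5.

Record harborth_near (R : realType) (t T : R) (D E F G H J : R * R) : Prop :=
  HarborthNear {
    near_t : near1 t 99269%:R;
    near_T : near1 T 12073%:R;
    near_xD : near1 D.1 81000%:R;
    near_yD : near1 D.2 276016%:R;
    near_xE : near1 E.1 20910%:R;
    near_yE : near1 E.2 196083%:R;
    near_xF : near1 F.1 (- 6140%:R);
    near_yF : near1 F.2 99811%:R;
    near_xG : near1 G.1 (- 83842%:R);
    near_yG : near1 G.2 162759%:R;
    near_xH : near1 H.1 (- 99505%:R);
    near_yH : near1 H.2 362144%:R;
    near_xJ : near1 J.1 (- 99505%:R);
    near_yJ : near1 J.2 63993%:R
  }.

Lemma harborth_approx_near (R : realType) (t T : R) (D E F G H J : R * R) :
  harborth_approx t T D E F G H J -> harborth_near t T D E F G H J.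
Proof.
by case=> *; split;
  match goal with h : approx15 ?x _ |- near1 ?x _ =>
    move: h; clear; rewrite /approx15 /near1 => /ler_normlP[lx ux];
    apply/ler_normlP; split; lra
  end.
Qed.

(* [p q + r s - (p' q' + r' s')] is the linear form with coefficients
   the means of [p, p'], ..., each of which is within [2 / N] of
   [cp / N], ... *)
Lemma bilinear_diff (R : realFieldType)
    (N cp cq cr cs S p p' q q' r r' s s' L : R) :
    `|N * p - cp| <= 2 -> `|N * p' - cp| <= 2 ->
    `|N * q - cq| <= 2 -> `|N * q' - cq| <= 2 ->
    `|N * r - cr| <= 2 -> `|N * r' - cr| <= 2 ->
    `|N * s - cs| <= 2 -> `|N * s' - cs| <= 2 ->
    `|p - p'| <= 3 * S -> `|q - q'| <= 3 * S ->
    `|r - r'| <= 3 * S -> `|s - s'| <= 3 * S ->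
    p * q + r * s = p' * q' + r' * s' ->
    cp * (q - q') + cq * (p - p') + cr * (s - s') + cs * (r - r') = L ->
  `|L| <= 24 * S.
Proof.
(* Each of the four terms costs 2 * 3S = 6S, whence the total 24S. *)
have mean_near (c x x' y y' : R) : `|N * x - c| <= 2 ->
    `|N * x' - c| <= 2 -> `|y - y'| <= 3 * S ->
  `|(c - N * ((x + x') / 2)) * (y - y')| <= 6 * S.
  move=> /ler_normlP[lx ux] /ler_normlP[lx' ux'] ley.
  have le2 : `|c - N * ((x + x') / 2)| <= 2 by apply/ler_normlP; split; lra.
  by rewrite normrM (le_trans (ler_pM _ _ le2 ley)) ?normr_ge0 //; lra.
have sum4 (a b c d : R) : `|a| <= 6 * S -> `|b| <= 6 * S -> `|c| <= 6 * S ->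
    `|d| <= 6 * S -> `|a + b + c + d| <= 24 * S.
  move=> /ler_normlP[? ?] /ler_normlP[? ?] /ler_normlP[? ?] /ler_normlP[? ?].
  by apply/ler_normlP; split; lra.
move=> hp hp' hq hq' hr hr' hs hs' dp dq dr ds eq_pq <-.
have -> : cp * (q - q') + cq * (p - p') + cr * (s - s') + cs * (r - r') =
    (cp - N * ((p + p') / 2)) * (q - q') + (cq - N * ((q + q') / 2)) * (p - p') +
    (cr - N * ((r + r') / 2)) * (s - s') + (cs - N * ((s + s') / 2)) * (r - r')
    + N * (p * q + r * s - (p' * q' + r' * s')) by field.
rewrite eq_pq subrr mulr0 addr0.
by apply: sum4; [apply: mean_near hp hp' dq | apply: mean_near hq hq' dp |
                 apply: mean_near hr hr' ds | apply: mean_near hs hs' dr].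
Qed.

Lemma sum_sq_diff (R : realFieldType) (N cp cr S p p' r r' L : R) :
    `|N * p - cp| <= 2 -> `|N * p' - cp| <= 2 ->
    `|N * r - cr| <= 2 -> `|N * r' - cr| <= 2 ->
    `|p - p'| <= 3 * S -> `|r - r'| <= 3 * S ->
    p ^+ 2 + r ^+ 2 = p' ^+ 2 + r' ^+ 2 ->
    2 * cp * (p - p') + 2 * cr * (r - r') = L ->
  `|L| <= 24 * S.
Proof.
move=> hp hp' hr hr' dp dr eq_sq <-.
apply: (bilinear_diff hp hp' hp hp' hr hr' hr hr' dp dp dr dr); last by ring.
by rewrite -!expr2.
Qed.

(** Opens only the bounds on variables of the goal and drops the others, to keep the [lra] problems
    small. *)
Ltac near_lra :=
  repeat match goal with
  | h : near1 ?x _ |- ?g =>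
      lazymatch g with
      | context [x] => move: h; rewrite /near1 => /ler_normlP[? ?]
      | _ => clear h
      end
  | h : is_true (`|?x - _| <= _) |- ?g =>
      lazymatch g with
      | context [x] => move: h => /ler_normlP[? ?]
      | _ => clear h
      end
  | h : _ = _ |- _ => clear h
  end;
  apply/ler_normlP; split; lra.

Lemma sqdist_diff (R : realType)
    (xP yP xQ yQ xP' yP' xQ' yQ' a b c d S k L : R) :
    near1 xP a -> near1 yP b -> near1 xQ c -> near1 yQ d ->
    near1 xP' a -> near1 yP' b -> near1 xQ' c -> near1 yQ' d ->
    `|xP - xP'| <= S -> `|yP - yP'| <= S -> `|xQ - xQ'| <= S -> `|yQ - yQ'| <= S ->
    (xP - xQ) ^+ 2 + (yP - yQ) ^+ 2 = k ->
    (xP' - xQ') ^+ 2 + (yP' - yQ') ^+ 2 = k ->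
    2 * (a - c) * (xP - xP' - (xQ - xQ')) + 2 * (b - d) * (yP - yP' - (yQ - yQ')) = L ->
  `|L| <= 24 * S.
Proof.
move=> nxP nyP nxQ nyQ nxP' nyP' nxQ' nyQ' sxP syP sxQ syQ <- /esym eq_k <-.
apply: (@sum_sq_diff _ 100000%:R (a - c) (b - d) S (xP - xQ) (xP' - xQ')
          (yP - yQ) (yP' - yQ')) => //; last by ring.
all: by near_lra.
Qed.

Lemma harborth_rigid (R : realType) (t T : R) (D E F G H J : R * R)
    (t' T' : R) (D' E' F' G' H' J' : R * R) :
    harborth_system t T D E F G H J -> harborth_near t T D E F G H J ->
    harborth_system t' T' D' E' F' G' H' J' ->
    harborth_near t' T' D' E' F' G' H' J' ->
  [/\ G = G', H = H' & J = J'].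
Proof.
move: D E F G H J => [xD yD] [xE yE] [xF yF] [xG yG] [xH yH] [xJ yJ].
move: D' E' F' G' H' J' => [xD' yD'] [xE' yE'] [xF' yF'] [xG' yG'] [xH' yH'] [xJ' yJ'].
case=> e0 e1 e2 e3 e4 e5 e6 e7 e8 e9 e10 e11 e12 e13.
case=> nt nT nxD nyD nxE nyE nxF nyF nxG nyG nxH nyH nxJ nyJ.
case=> e0' e1' e2' e3' e4' e5' e6' e7' e8' e9' e10' e11' e12' e13'.
case=> nt' nT' nxD' nyD' nxE' nyE' nxF' nyF' nxG' nyG' nxH' nyH' nxJ' nyJ'.
unfold sqdist in *; cbn [fst snd] in *.
set ds := [:: t - t'; T - T'; xD - xD'; yD - yD'; xE - xE';
               yE - yE'; xF - xF'; yF - yF'; xG - xG'; yG - yG';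
               xH - xH'; yH - yH'; xJ - xJ'; yJ - yJ'].
pose S := \sum_(d <- ds) `|d|.
have leS i : (i < 14)%N -> `|nth 0 ds i| <= S by move=> ?; apply/le_sum_norm/mem_nth.
have /= s0 := leS 0%N isT.
have /= s1 := leS 1%N isT.
have /= s2 := leS 2%N isT.
have /= s3 := leS 3%N isT.
have /= s4 := leS 4%N isT.
have /= s5 := leS 5%N isT.
have /= s6 := leS 6%N isT.
have /= s7 := leS 7%N isT.
have /= s8 := leS 8%N isT.
have /= s9 := leS 9%N isT.
have /= s10 := leS 10%N isT.
have /= s11 := leS 11%N isT.
have /= s12 := leS 12%N isT.
have /= s13 := leS 13%N isT.
have S0 : S = 0.
  clear leS; apply: linearized_rigid; last by rewrite e13 e13'.
  - apply: (@sum_sq_diff _ 100000%:R 99269%:R 12073%:R S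
              (t) (t') (T) (T') _ _ _ _ _ _ _ (etrans e0 (esym e0')));
      last (by ring); by near_lra.
  (* Centers of compound terms: -117538 = 81000 - 2 * 99269 and, below, -78359 = 20910 - 99269 and
     184010 = 196083 - 12073. *)
  - apply: (@bilinear_diff _ 100000%:R (- 99269%:R) (- 117538%:R) 12073%:R 276016%:R S
              (- t) (- t') (xD - 2 * t) (xD' - 2 * t') (T) (T') (yD) (yD'));
      last (by ring); last (by clear -e1 e1'; lra); by near_lra.
  - apply: (@sum_sq_diff _ 100000%:R (- 117538%:R) 276016%:R S
              (xD - 2 * t) (xD' - 2 * t') (yD) (yD') _ _ _ _ _ _ _ (etrans e2 (esym e2')));
      last (by ring); by near_lra.
  - apply: (@bilinear_diff _ 100000%:R 99269%:R (- 78359%:R) (- 12073%:R) 184010%:R S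
              (t) (t') (xE - t) (xE' - t') (- T) (- T') (yE - T) (yE' - T'));
      last (by ring); last (by clear -e3 e3'; lra); by near_lra.
  - apply: (@sum_sq_diff _ 100000%:R (- 78359%:R) 184010%:R S
              (xE - t) (xE' - t') (yE - T) (yE' - T') _ _ _ _ _ _ _ (etrans e4 (esym e4')));
      last (by ring); by near_lra.
  - apply: (@sum_sq_diff _ 100000%:R (- 6140%:R) 99811%:R S
              (xF) (xF') (yF) (yF') _ _ _ _ _ _ _ (etrans e5 (esym e5')));
      last (by ring); by near_lra.
  - apply: (sqdist_diff nxE nyE nxF nyF nxE' nyE' nxF' nyF'
              s4 s5 s6 s7 e6 e6'); ring.
  - apply: (sqdist_diff nxF nyF nxG nyG nxF' nyF' nxG' nyG'
              s6 s7 s8 s9 e7 e7'); ring.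
  - apply: (sqdist_diff nxD nyD nxG nyG nxD' nyD' nxG' nyG'
              s2 s3 s8 s9 e8 e8'); ring.
  - apply: (sqdist_diff nxD nyD nxH nyH nxD' nyD' nxH' nyH'
              s2 s3 s10 s11 e9 e9'); ring.
  - apply: (sqdist_diff nxG nyG nxH nyH nxG' nyG' nxH' nyH'
              s8 s9 s10 s11 e10 e10'); ring.
  - apply: (sqdist_diff nxF nyF nxJ nyJ nxF' nyF' nxJ' nyJ'
              s6 s7 s12 s13 e11 e11'); ring.
  - apply: (sqdist_diff nxG nyG nxJ nyJ nxG' nyG' nxJ' nyJ'
              s8 s9 s12 s13 e12 e12'); ring.
rewrite S0 in s8 s9 s10 s11 s12 s13.
split; congr pair; apply/eqP; rewrite -subr_eq0 -normr_le0 //.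
Qed.

(** * Enclosures *)

Lemma zr_le (R : realDomainType) (a b : Z) : Z.le a b -> zr R a <= zr R b.
Proof.
move=> leab; rewrite -subr_ge0 -zrN -zrD -(Z2Nat.id (Z.add b (Z.opp a))).
  by rewrite zr_nat ler0n.
exact/Z.le_0_sub.
Qed.

Lemma zr_lt (R : realDomainType) (a b : Z) : Z.lt a b -> zr R a < zr R b.
Proof.
move=> /Z.le_succ_l /(zr_le R); apply: lt_le_trans.
by rewrite -Z.add_1_r zrD ltrDl ltr01.
Qed.

Lemma zr_abs (R : realDomainType) (a : Z) : zr R (Z.abs a) = `|zr R a|.
Proof.
have [[a0 ->]|[/Z.lt_le_incl a0 ->]] := Z.abs_spec a.
  by rewrite ger0_norm // (zr_le R a0).
by rewrite zrN ler0_norm // (zr_le R a0).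
Qed.

(* For [(B, m, r) := encl a b d l], [B * ev l x] is within [r] of [m] whenever
   [b * x] is within [d] of [a]. *)
Definition encl (a b d : Z) : seq Z -> Z * Z * Z :=
  foldr (fun c '(B, m, r) =>
           (Z.mul B b, Z.add (Z.mul c (Z.mul B b)) (Z.mul a m),
            Z.add (Z.mul (Z.add (Z.abs a) d) r) (Z.mul d (Z.abs m))))
        (Zpos 1, Z0, Z0).

Definition encl_pos (a b d : Z) (l : seq Z) : bool :=
  let: (_, m, r) := encl a b d l in Z.ltb r m.

Lemma enclP (R : realDomainType) (a b d : Z) (x : R) (l : seq Z) :
    Z.lt Z0 b -> `|zr R b * x - zr R a| <= zr R d ->
  let: (B, m, r) := encl a b d l in
  Z.lt Z0 B /\ `|zr R B * ev l x - zr R m| <= zr R r.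
Proof.
move=> b_gt0 xab; have bx : `|zr R b * x| <= `|zr R a| + zr R d.
  by rewrite -[zr R b * x](subrK (zr R a)) (le_trans (ler_normD _ _)) // addrC lerD2l.
elim: l => [|c l] /=; first by rewrite /zr /= mul1r subr0 normr0.
case: (encl a b d l) => [[B m] r] [B_gt0 IHl]; split; first exact: Z.mul_pos_pos.
rewrite !(zrD, zrM) !zr_abs.
(* The error of a Horner step splits into the inherited error times b * x and the error of the
   argument times [m]. *)
have -> : zr R B * zr R b * (zr R c + x * ev l x) -
    (zr R c * (zr R B * zr R b) + zr R a * zr R m) =
    zr R b * x * (zr R B * ev l x - zr R m) + (zr R b * x - zr R a) * zr R m by ring.
rewrite (le_trans (ler_normD _ _)) // (normrM (_ * x)) (normrM (_ - _)).
by rewrite lerD // ?ler_pM.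
Qed.

Lemma ev_gt0 (R : realDomainType) (a b d : Z) (x : R) (l : seq Z) :
    Z.lt Z0 b -> `|zr R b * x - zr R a| <= zr R d -> encl_pos a b d l ->
  0 < ev l x.
Proof.
move=> b_gt0 xab; have := enclP l b_gt0 xab; rewrite /encl_pos.
case: (encl a b d l) => [[B m] r] [/(zr_lt R) B_gt0 /ler_normlP[lem _]].
move=> /Z.ltb_spec0 /(zr_lt R) ltrm; rewrite -(pmulr_rgt0 _ B_gt0).
by move: lem; rewrite opprB lerBlDr => /(lt_le_trans ltrm); rewrite ltrDl.
Qed.

(** With radius 0 the enclosures are exact evaluations, so the checks exhibit a sign change between
    a / b and (a + 1) / b. *)
Lemma ev_root (R : rcfType) (a b : Z) (l : seq Z) : Z.lt Z0 b ->
    encl_pos a b Z0 (pscale (Zneg 1) l) -> encl_pos (Z.succ a) b Z0 l ->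
  exists2 x : R, `|zr R b * x - zr R a| <= 1 & ev l x = 0.
Proof.
move=> b_gt0 neg_l pos_l; have b_gt0' := zr_lt R b_gt0.
have end_near (c : Z) : `|zr R b * (zr R c / zr R b) - zr R c| <= zr R Z0.
  by rewrite mulrC divfK ?gt_eqF // subrr normr0.
have := ev_gt0 b_gt0 (end_near _) neg_l; rewrite ev_scale mulN1r oppr_gt0.
have := ev_gt0 b_gt0 (end_near _) pos_l; rewrite !evE => /ltW pos /ltW neg.
have [||x /andP[ax xb] /rootP x0] := poly_ivt _ _ (p := Poly [seq zr R c | c <- l])
    (a := zr R a / zr R b) (b := zr R (Z.succ a) / zr R b).
- by rewrite ler_pM2r ?invr_gt0 // zr_le //; apply: Z.le_succ_diag_r.
- by rewrite neg pos.
exists x; last by rewrite evE.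
move: ax xb; rewrite ler_pdivrMr // ler_pdivlMr // -Z.add_1_r zrD => ax xb.
have z1 : zr R 1 = 1 by []; rewrite z1 in xb.
by apply/ler_normlP; split; lra.
Qed.

(** If k * x^2 = w and b * w is within 1 of [a], these inequalities squeeze (n * x)^2 between (c -
    1)^2 and (c + 1)^2; 1 <= c allows taking roots. *)
Definition sqrt_check (a b c k n : Z) : bool :=
  [&& Z.leb 1 c,
      Z.leb (k * b * ((c - 1) * (c - 1))) ((a - 1) * (n * n)) &
      Z.leb ((a + 1) * (n * n)) (k * b * ((c + 1) * (c + 1)))]%coqZ.

Lemma sqrt_near (R : realDomainType) (a b c k n : Z) (w x : R) :
    Z.lt Z0 b -> Z.lt Z0 k -> Z.lt Z0 n -> 0 <= x -> zr R k * x ^+ 2 = w ->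
    `|zr R b * w - zr R a| <= 1 -> sqrt_check a b c k n ->
  `|zr R n * x - zr R c| <= 1.
Proof.
move=> /(zr_lt R) b_gt0 /(zr_lt R) k_gt0 /(zr_lt R) n_gt0 x_ge0 <- /ler_normlP[la ua].
case/and3P=> /Z.leb_spec0/(zr_le R) c_ge1 /Z.leb_spec0/(zr_le R) lo /Z.leb_spec0/(zr_le R) hi.
have z1 : zr R 1 = 1 by [].
rewrite !(zrM, zrD, zrN) z1 in c_ge1 lo hi *.
have kb_gt0 : 0 < zr R k * zr R b by rewrite mulr_gt0.
have nx_ge0 : 0 <= zr R n * x by rewrite mulr_ge0 // ltW.
have n2 : 0 <= zr R n * zr R n by rewrite mulr_ge0 ?ltW.
move: (zr R b) (zr R a) (zr R c) (zr R n) (zr R k) => rb ra rc rn rk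
  in b_gt0 k_gt0 n_gt0 la ua c_ge1 lo hi kb_gt0 nx_ge0 n2 *.
have hi' : (rn * x) ^+ 2 <= (rc + 1) ^+ 2.
  rewrite -(ler_pM2l kb_gt0); apply: le_trans hi.
  have -> : rk * rb * (rn * x) ^+ 2 = rb * (rk * x ^+ 2) * (rn * rn) by ring.
  by rewrite ler_wpM2r //; lra.
have lo' : (rc - 1) ^+ 2 <= (rn * x) ^+ 2.
  rewrite -(ler_pM2l kb_gt0); apply: le_trans lo _.
  have -> : rk * rb * (rn * x) ^+ 2 = rb * (rk * x ^+ 2) * (rn * rn) by ring.
  by rewrite ler_wpM2r //; lra.
move: hi' lo'; rewrite !ler_sqr ?nnegrE //; try by lra.
by move=> ? ?; apply/ler_normlP; split; lra.
Qed.

(** * Elements of Q(w) as fractions over a common denominator *)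

Definition fr (K : fieldType) (M a : seq Z) (w : K) : K := ev a w / ev M w.

Lemma fr_sub (K : fieldType) (M a b : seq Z) (w : K) :
  fr M (psub a b) w = fr M a w - fr M b w.
Proof. by rewrite /fr ev_sub mulrBl. Qed.

Lemma fr_scale (K : fieldType) (M a : seq Z) (c : Z) (w : K) :
  fr M (pscale c a) w = zr K c * fr M a w.
Proof. by rewrite /fr ev_scale mulrA. Qed.

(* The common value of [12 * (x * x' + y * y')] for [x = alpha * X / M],
   [y = beta * Y / M] and so on, where [alpha^2 = w / 4] and [beta^2 = w / 12]. *)
Definition bilin_check (f M X X' Y Y' : seq Z) (c : Z) : bool :=
  nilp (prem f (psub (Z0 :: padd (pscale 3 (pmul X X')) (pmul Y Y'))
                     (pscale c (pmul M M)))).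

Lemma bilin_checkP (R : realFieldType) (f M X X' Y Y' : seq Z) (c : Z)
    (w alpha beta : R) :
    ev f w = 0 -> ev M w != 0 -> 4 * alpha ^+ 2 = w -> 12 * beta ^+ 2 = w ->
    bilin_check f M X X' Y Y' c ->
  12 * (alpha * fr M X w * (alpha * fr M X' w) + beta * fr M Y w * (beta * fr M Y' w))
    = zr R c.
Proof.
move=> fw M_neq0 aw bw /nilP eq0; have := congr1 (fun l => ev l w) eq0.
rewrite /= ev_rem // ev_sub ev_scale ev_mul.
rewrite /= ev_add ev_scale !ev_mul {1}/zr /= add0r => /eqP; rewrite subr_eq0 => /eqP eqM.
(* The weights 3 and 1 come from 12 * alpha^2 = 3 * w and 12 * beta^2 = w. *)
have -> : 12 * (alpha * fr M X w * (alpha * fr M X' w) + beta * fr M Y w * (beta * fr M Y' w))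
  = (3 * (4 * alpha ^+ 2) * (ev X w * ev X' w) + 12 * beta ^+ 2 * (ev Y w * ev Y' w)) /
    (ev M w * ev M w) by rewrite /fr; field.
rewrite aw bw; apply: (canLR (mulfK _)); first by rewrite mulf_neq0.
by rewrite -eqM; have -> : zr R 3 = 3 by []; ring.
Qed.

Lemma near1_zr (R : realType) (x c : R) :
  `|zr R 100000 * x - c| <= 3 / 5 -> near1 x c.
Proof. by rewrite /near1; generalize_numerals. Qed.

(* Only an ansatz, validated by [coord_check]; it presupposes that [l] and [M]
   have the same size. *)
Definition fr_approx (a b n : Z) (M l : seq Z) : Z :=
  Z.div (n * (encl a b 0 l).1.2) (encl a b 0 M).1.2.

(** The first two tests put n * l(w) / M(w) within 1 of [q]. As n * alpha is within 1 of [ca], their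
    product is within |ca| + |q| + 1 of ca * q, and the last test turns this into the radius 3/5. *)
Definition coord_check (a b n m ca : Z) (M l : seq Z) (c : Z) : bool :=
  let q := fr_approx a b n M l in
  [&& encl_pos a b 1 (psub (pscale n l) (pscale (q - 1) M)),
      encl_pos a b 1 (psub (pscale (q + 1) M) (pscale n l)) &
      Z.leb (5 * (Z.abs (m * (ca * q) - c * (n * n)) +
                  m * (Z.abs ca + Z.abs q + 1)))
            (3 * (n * n))]%coqZ.

Lemma coord_checkP (R : realType) (a b n m ca c : Z) (M l : seq Z) (w alpha : R) :
    Z.lt Z0 b -> Z.lt Z0 n -> Z.le Z0 m -> `|zr R b * w - zr R a| <= zr R 1 -> 0 < ev M w ->
    `|zr R n * alpha - zr R ca| <= 1 -> coord_check a b n m ca M l c ->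
  `|zr R m * (alpha * fr M l w) - zr R c| <= 3 / 5.
Proof.
move=> b_gt0 /(zr_lt R) n_gt0 /(zr_le R) m_ge0 wab M_gt0 al_ca; rewrite /coord_check.
move: (fr_approx a b n M l) => q /and3P[/(ev_gt0 b_gt0 wab) lo /(ev_gt0 b_gt0 wab) hi].
have z1 : zr R 1 = 1 by [].
rewrite !(ev_sub, ev_scale, zrD, zrN) z1 in lo hi.
move=> /Z.leb_spec0/(zr_le R); rewrite !(zrD, zrM, zr_abs, zrN) z1.
have -> : zr R 3 = 3 by [].
have -> : zr R 5 = 5 by [].
have fr_q : `|zr R n * fr M l w - zr R q| <= 1.
  rewrite /fr mulrA; apply/ler_normlP; rewrite opprB !lerBlDr.
  rewrite ler_pdivrMr // -lerBlDl ler_pdivlMr //; split; lra.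
move: (zr R n) (zr R q) (zr R ca) (zr R c) (fr M l w) (zr R m) => rn rq rca rc y N
  in n_gt0 m_ge0 al_ca fr_q *.
move=> bound; have n2_gt0 : 0 < rn * rn by rewrite mulr_gt0.
have prod_near : `|rn * rn * (alpha * y) - rca * rq| <= `|rca| + `|rq| + 1.
  have -> : rn * rn * (alpha * y) - rca * rq = rca * (rn * y - rq) + rq * (rn * alpha - rca)
      + (rn * alpha - rca) * (rn * y - rq) by ring.
  rewrite (le_trans (ler_normD _ _)) // lerD ?(le_trans (ler_normD _ _)) // ?lerD //.
  - by rewrite normrM ler_piMr.
  - by rewrite normrM ler_piMr.
  - by rewrite normrM mulr_ile1.
rewrite -(ler_pM2l n2_gt0) -{1}(gtr0_norm n2_gt0) -normrM.
have -> : rn * rn * (N * (alpha * y) - rc) =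
  N * (rn * rn * (alpha * y) - rca * rq) + (N * (rca * rq) - rc * (rn * rn)) by ring.
have := ler_wpM2l m_ge0 prod_near; rewrite -{1}(ger0_norm m_ge0) -normrM => prod_near'.
by rewrite (le_trans (ler_normD _ _)) //; lra.
Qed.

(** * The configuration over its number field *)

(* [w = 12 T^2] is a root of [w_poly], and every abscissa (resp. ordinate) of the
   configuration is [sqrt 3 * T] (resp. [T]) times an element of Q(w), written
   over the common denominator [den = 3 * w_poly^`()]; [sqrt 3 * T] is also the
   abscissa of E. The powers of y_G are [y_G^2 = sq_yG / (2 * den)],
   and [pow4_yG / V], [pow6_yG / V], [pow8_yG / V] with [V = 2 * k * den] for the
   [k] used in [w_point_roots]; similarly for y_H and y_J. *)
Definition w_poly : seq Z := [:: -87169610025; 772903875555; -1773481858479;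
  1252951342209; -517427963712; 135083562948; -24778193868; 3001039308; -269873856;
  15316272; -1207536; 104272]%coqZ.

Definition den : seq Z := [:: 2318711626665; -10640891150874;
  11276562079881; -6209135564544; 2026253444220; -446007489624;
  63021825468; -6476972544; 413539344; -36226080; 3440976]%coqZ.

Definition num_t : seq Z := [:: 5255358933285; -10079045348382;
  5747239465245; -1353089175516; 64185554412; 62002132344; -16704122292;
  2523309408; -148006800; 4595712; -729904]%coqZ.

Definition num_xD : seq Z := [:: 6105746906640; -21000859400502;
  19788462852444; -9990247934574; 3071472943536; -638010168264;
  86180677056; -8453804112; 546305616; -52041264; 4796512]%coqZ.

Definition num_yD : seq Z := [:: 27127182639780; -61317040794030;
  42777420713424; -15402604636638; 3328215161184; -390001638888; 19364187888;
  1639433520; -45721584; -33658416; 1876896]%coqZ.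

Definition num_yE : seq Z := [:: 20403500053185; -51518918346894;
  39794842555497; -16477538655636; 4245063551676; -706008582216;
  75931284060; -5384016864; 383058288; -58665024; 4692240]%coqZ.

Definition num_xF : seq Z := [:: 927872071155; -7165557177660;
  3550048731963; -1957372667622; 886887636480; -291154137768;
  50991383412; -6619958928; 434997792; -30967728; 3232432]%coqZ.

Definition num_yF : seq Z := [:: 11361105839925; -33580058304564;
  31775468015709; -16588124087562; 5246212656528; -1017516464136;
  124311958092; -10008672336; 526970016; -68022288; 5943504]%coqZ.

Definition num_xG : seq Z := [:: -3196219034250; 912418298316; -1981191853242;
  949872134232; -83903905080; -51849430992; 17608680072; -2817988704;
  210706272; -21910464; 1876896]%coqZ.

Definition num_yG : seq Z := [:: 16655206822110; -40530898437876;
  29157237304326; -11978926728624; 3194921255328; -530331036264;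
  54243426168; -3267696816; 184970304; -40303584; 3128160]%coqZ.

Definition num_xH : seq Z := [:: -3781223972640; 348850626984;
  2093543795052; -2808348946164; 1427137566300; -415094498316;
  69334297704; -8089461576; 493851888; -40298448; 3962336]%coqZ.

Definition num_yH : seq Z := [:: 35844143642280; -83793886164180;
  68621811067404; -30100945785840; 7994633481180; -1339407443484;
  139661802504; -9267854760; 573023376; -82177200; 6881952]%coqZ.

Definition num_yJ : seq Z := [:: 7822019672910; -24938515157256;
  22169491782210; -9922658205312; 2764379643588; -414966690036;
  39203637120; -935229240; 19532880; -40577040; 2502528]%coqZ.

Definition sq_yG : seq Z := [:: 9850165932825; -38625822753300;
  35398308752883; -18001918705626; 5292985487526; -1172252793996;
  183099979008; -26313727392; 2443282056; -224777088; 15690000]%coqZ.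

Definition sq_yH : seq Z := [:: 48780113769990; -181586307717234;
  111414771647109; -39044150787978; 8814967757397; -1868047591950;
  328835810970; -52728240492; 5692455468; -582216912; 39695520]%coqZ.

Definition sq_yJ : seq Z := [:: 1394713760400; -4730404170690; 925289267895;
  7528058398170; -4843184985387; 1270458721170; -166600310598; 7569379044;
  1480866300; -183328272; 4123872]%coqZ.

Definition pow4_yG : seq Z := [::
  911966758577448960415629600; -3674738721358261389969400320;
  4096629312433907343774706656; -2190481394499879175870511616;
  675546590734186869093380544; -151129868029740016294699584;
  26835662664988634987566848; -4205091483493423796714112;
  530542200044122182217728; -45562458421880272035072; 1842404338399813762560]%coqZ.

Definition pow6_yG : seq Z := [::
  2600499005847249976982230200; -11686970596567083885071151840;
  16901499009358361998837466712; -11558485976045616905493915936;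
  4680890040394194259237868592; -1304065614113589055249564848;
  260123688583471176740088624; -37986667973197897345086240;
  4082271331642194042324000; -309730230885115064352384;
  11763533945314036947264]%coqZ.

Definition pow8_yG : seq Z := [::
  7475110546612024907263376325; -36980819588581164655711282665;
  63404479367460805720349680587; -51934809809223256813776606987;
  24890040400611159389756676240; -7944368816103444751057127028;
  1748933531222266520343504144; -267020825298094115161767720;
  27586641531649778207033544; -1761220259465530693796856;
  51958424504615420731344]%coqZ.

Definition pow4_yH : seq Z := [::
  42559491645947057574212249760; -151040474420512377358350364896;
  93005632440590720075532992160; -37208856216186504037250485920;
  10011288326638280535963297216; -2410993127662604694396528768;
  445534595305331859175871232; -78197812871005385267044608;
  8654941409171669267862528; -814807496117054501091072;
  50661780086130056739840]%coqZ.

Definition pow6_yH : seq Z := [::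
  538146206098006758594704898480; -1860145488159229291986900606168;
  1172434047654523723676911594584; -417320972565269786074038421080;
  97901798217196704005082527496; -23326106322483543938932057968;
  5497268090513480708058816912; -1166807670609977594106703200;
  163564457719628157289394976; -14700610837172275805643840;
  648435978067323074111616]%coqZ.

Definition pow8_yH : seq Z := [::
  7053025048242436067001472806165; -25015237326399563512446755988459;
  19730917087749040509319034233143; -9554423332812559130968576431201;
  3195537781854249255310824863124; -850467541529033903017210252680;
  177817032528327282883153705524; -30324649433097120625840152240;
  3733893273051327431978593416; -311476902649850105361449496;
  12920347370556279391266912]%coqZ.

Definition pow4_yJ : seq Z := [::
  381728920781926546180279200; -3623490945875252129887772640;
  10931077650152395342036497312; -13001385149195243843436039072;
  6205485557496961138722637248; -1793717167469514617640868992;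
  304186276197298956305117952; -41948945704955936784404736;
  3586017089058545052656640; -321467233039298099212032;
  23380231125282764737536]%coqZ.

Definition pow6_yJ : seq Z := [::
  12293248195268271868702993200; -103188378230528375012270003640;
  199927393400886440980228591032; -67868667884484221021525995128;
  9669489870558609814152529512; -55126787652866155889425392;
  358043432662195669813885776; -102771384755685343288571232;
  24586019462649113817600672; -2323806595522841660341824;
  36270046958591736807552]%coqZ.

Definition pow8_yJ : seq Z := [:: -159444051934816834397797434075;
  1340097613558397676255464613765; -2596954629068904616163628751737;
  849421268200841420030651902575; -27822728227015312857707297868; -71947417864274893469697058440;
  20338678619346917443522644468; -3944269827906644260537463088;
  399668636757795711616235016; -29231384845177765128544920;
  1734351649534711930582368]%coqZ.

(* Horner's scheme in steps of four, cleared of denominators: for [u = U1 / V],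
   [u^2 = U2 / V], ..., [u^4 = U4 / V] the value is [V^n * g(u)]. *)
Definition phom4 (V U1 U2 U3 U4 : seq Z) (s : seq (Z * Z * Z * Z)) : seq Z * seq Z :=
  foldr (fun '(c0, c1, c2, c3) '(P, W) =>
           let A := padd (padd (pscale c0 V) (pscale c1 U1))
                         (padd (pscale c2 U2) (pscale c3 U3)) in
           (padd (pmul A W) (pmul U4 P), pmul V W))
        ([::], [:: Zpos 1]) s.

Lemma ev_phom4 (K : fieldType) (V U1 U2 U3 U4 : seq Z) (s : seq (Z * Z * Z * Z))
    (x u : K) :
    ev U1 x = ev V x * u -> ev U2 x = ev V x * u ^+ 2 -> ev U3 x = ev V x * u ^+ 3 ->
    ev U4 x = ev V x * u ^+ 4 ->
  ev (phom4 V U1 U2 U3 U4 s).1 x = ev V x ^+ size s * ev (unquad s) u /\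
  ev (phom4 V U1 U2 U3 U4 s).2 x = ev V x ^+ size s.
Proof.
move=> U1x U2x U3x U4x; elim: s => [|[[[c0 c1] c2] c3] s] /=.
  by rewrite mulr0 /zr /= mulr0 addr0.
case: (phom4 V U1 U2 U3 U4 s) => P W /= [IHP IHW].
rewrite !(ev_add, ev_scale, ev_mul) IHP IHW U1x U2x U3x U4x (exprS (ev V x)); split=> //.
by rewrite -/(unquad s); ring.
Qed.

(** With u = y^2 and beta^2 = w / 12, the first congruence says u = U / (2 * den). The next three
    identify [U2], [U3], [U4] as numerators of u^2, u^3, u^4 over [V], and the last is the
    polynomial in u cleared of denominators. *)
Definition root_check (Y U : seq Z) (k : Z) (U2 U3 U4 : seq Z)
    (s : seq (Z * Z * Z * Z)) : bool :=
  let V := pscale (2 * k) den in let U1 := pscale k U in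
  [&& nilp (prem w_poly (psub (Z0 :: pmul Y Y) (pscale 6 (pmul den U)))),
      nilp (prem w_poly (psub (pmul U1 U1) (pmul V U2))),
      nilp (prem w_poly (psub (pmul U1 U2) (pmul V U3))),
      nilp (prem w_poly (psub (pmul U1 U3) (pmul V U4))) &
      nilp (prem w_poly (phom4 V U1 U2 U3 U4 s).1)].

Lemma prem_nil (K : comNzRingType) (w : K) (a : seq Z) :
  ev w_poly w = 0 -> nilp (prem w_poly a) -> ev a w = 0.
Proof. by move=> w_root /nilP a0; rewrite -(ev_rem a w_root) a0. Qed.

Lemma sq_ratio (R : realFieldType) (w b y m u : R) :
    m != 0 -> 12 * b = w -> w * y = 6 * (m * u) ->
  b * (y / (m * m)) = u / (2 * m).
Proof.
move=> m_neq0 <- eq12; have -> : u = 2 * b * y / m; last by field.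
by apply: (canRL (mulfK m_neq0)); lra.
Qed.

Lemma half_ratio (R : realFieldType) (k u m : R) :
  m != 0 -> k * u = 2 * k * m * (u / (2 * m)).
Proof. by move=> m_neq0; field. Qed.

Lemma next_power (R : realFieldType) (n : nat) (v a b c u : R) :
  v != 0 -> a = v * u -> b = v * u ^+ n -> a * b = v * c -> c = v * u ^+ n.+1.
Proof.
move=> v_neq0 -> ->; rewrite -mulrA => /(mulfI v_neq0) <-.
by rewrite exprS mulrCA.
Qed.

Lemma root_checkP (R : realFieldType) (Y U : seq Z) (k : Z) (U2 U3 U4 : seq Z)
    (s : seq (Z * Z * Z * Z)) (P : {poly rat}) (w beta : R) :
    P = Poly [seq zr rat a | a <- pexpand2 (unquad s)] ->
    ev w_poly w = 0 -> 0 < ev den w -> 12 * beta ^+ 2 = w -> Z.lt Z0 k ->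
    root_check Y U k U2 U3 U4 s ->
  root (map_poly ratr P) (beta * fr den Y w).
Proof.
move=> -> w_root den_gt0 beta_w /(zr_lt R) k_gt0 /and5P[].
move=> /(prem_nil w_root) eqU /(prem_nil w_root) eqU2 /(prem_nil w_root) eqU3
  /(prem_nil w_root) eqU4 /(prem_nil w_root).
have den_neq0 : ev den w != 0 by rewrite gt_eqF.
have z2 : zr R 2 = 2 by []; have z6 : zr R 6 = 6 by [].
have evX : ev (Z0 :: pmul Y Y) w = w * (ev Y w * ev Y w).
  by rewrite /= ev_mul {1}/zr /= add0r.
move: eqU eqU2 eqU3 eqU4 => /eqP + /eqP + /eqP + /eqP.
rewrite !ev_sub evX !ev_mul !ev_scale ev_mul z6 zrM z2 !subr_eq0.
move=> /eqP wY /eqP eqU2 /eqP eqU3 /eqP eqU4.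
have V_neq0 : 2 * zr R k * ev den w != 0.
  by rewrite !mulf_neq0 ?pnatr_eq0 // gt_eqF.
have evU := half_ratio (zr R k) (ev U w) den_neq0.
have evU2 := next_power (n := 1) V_neq0 evU evU eqU2.
have evU3 := next_power (n := 2) V_neq0 evU evU2 eqU3.
have evU4 := next_power (n := 3) V_neq0 evU evU3 eqU4.
move=> eq0; have := @ev_phom4 _ (pscale (2 * k) den) (pscale k U) U2 U3 U4 s w
  (ev U w / (2 * ev den w)).
rewrite eq0 !ev_scale zrM z2 => /(_ evU evU2 evU3 evU4) [/esym/eqP + _].
rewrite mulf_eq0 expf_eq0 (negPf V_neq0) andbF orFb => /eqP eq_root.
apply/rootP; rewrite map_poly_zr -evE ev_expand2 -[RHS]eq_root; congr ev.
rewrite exprMn expr_div_n (expr2 (ev Y w)) (expr2 (ev den w)).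
exact: sq_ratio den_neq0 beta_w wY.
Qed.

(** * The real root and its square roots *)

Lemma sqr_sqrt_div (R : rcfType) (k w : R) :
  0 < k -> 0 <= w -> k * Num.sqrt (w / k) ^+ 2 = w.
Proof.
move=> k_gt0 w_ge0; rewrite sqr_sqrtr; first by rewrite mulrC divfK // gt_eqF.
by rewrite divr_ge0 // ltW.
Qed.

(** Fixed-point approximations of 12 T^2, sqrt 3 * T and T at the given solution. *)
Definition w_num : Z := 174895284084.
Definition w_den : Z := 10 ^ 12.
Definition alpha_num : Z := 20910242.
Definition beta_num : Z := 12072534.
Definition sqrt_den : Z := 10 ^ 8.

(* The centers in [near1] have this denominator. *)
Definition near_den : Z := 100000.

(* [alpha] and [beta] are [sqrt 3 * T] and [T]. *)
Record w_point (R : realType) (w alpha beta : R) : Prop := WPoint {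
  wp_root : ev w_poly w = 0;
  wp_den : 0 < ev den w;
  wp_near : `|zr R w_den * w - zr R w_num| <= zr R 1;
  wp_alpha : 4 * alpha ^+ 2 = w;
  wp_beta : 12 * beta ^+ 2 = w;
  wp_alpha_near : `|zr R sqrt_den * alpha - zr R alpha_num| <= 1;
  wp_beta_near : `|zr R sqrt_den * beta - zr R beta_num| <= 1
}.

Lemma w_den_gt0 : Z.lt Z0 w_den. Proof. by []. Qed.

Lemma sqrt_den_gt0 : Z.lt Z0 sqrt_den. Proof. by []. Qed.

Lemma w_poly_root (R : rcfType) :
  exists2 w : R, `|zr R w_den * w - zr R w_num| <= zr R 1 & ev w_poly w = 0.
Proof. by apply: ev_root; [exact: w_den_gt0 | vm_compute | vm_compute]. Qed.

Lemma w_point_exists (R : realType) : exists w alpha beta : R, w_point w alpha beta.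
Proof.
have [w w_near w_root] := w_poly_root R.
have w_ge0 : 0 <= w.
  (* Positivity of [w] is the enclosure of the polynomial X. *)
  have /ltW : 0 < ev [:: Z0; Zpos 1] w.
    by apply: (ev_gt0 w_den_gt0 w_near); vm_compute.
  by rewrite /= /zr /= add0r mulr0 addr0 mulr1.
have alpha_w : 4 * Num.sqrt (w / 4) ^+ 2 = w by apply: sqr_sqrt_div => //; rewrite ltr0n.
have beta_w : 12 * Num.sqrt (w / 12) ^+ 2 = w by apply: sqr_sqrt_div => //; rewrite ltr0n.
exists w, (Num.sqrt (w / 4)), (Num.sqrt (w / 12)); split.
- exact: w_root.
- by apply: (ev_gt0 w_den_gt0 w_near); vm_compute.
- exact: w_near.
- exact: alpha_w.
- exact: beta_w.
- apply: (@sqrt_near R w_num w_den alpha_num 4 sqrt_den w _ w_den_gt0 _ sqrt_den_gt0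
            (sqrtr_ge0 _) alpha_w w_near); first by [].
  by vm_compute.
- apply: (@sqrt_near R w_num w_den beta_num 12 sqrt_den w _ w_den_gt0 _ sqrt_den_gt0
            (sqrtr_ge0 _) beta_w w_near); first by [].
  by vm_compute.
Qed.

(** * The exact configuration *)

Definition coord (K : fieldType) (a : K) (l : seq Z) (w : K) : K := a * fr den l w.

Lemma w_point_bilin (R : realType) (w alpha beta : R) (k k' l l' : seq Z) (c : nat) :
    w_point w alpha beta -> bilin_check w_poly den k k' l l' (Z.of_nat c) ->
  12 * (coord alpha k w * coord alpha k' w + coord beta l w * coord beta l' w) = c%:R.
Proof.
case=> w_root den_gt0 _ alpha_w beta_w _ _; rewrite -(zr_nat _ c).
by apply: bilin_checkP => //; rewrite gt_eqF.
Qed.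

(** Up to signs, each equation but the last equates a product of abscissas plus a product of
    ordinates to a constant; [bilin_check] receives 12 times that constant. The last holds because H
    and J share one numerator. *)
Lemma w_point_system (R : realType) (w alpha beta : R) : w_point w alpha beta ->
  harborth_system (coord alpha num_t w) (coord beta den w)
    (coord alpha num_xD w, coord beta num_yD w)
    (coord alpha den w, coord beta num_yE w)
    (coord alpha num_xF w, coord beta num_yF w)
    (coord alpha num_xG w, coord beta num_yG w)
    (coord alpha num_xH w, coord beta num_yH w)
    (coord alpha num_xH w, coord beta num_yJ w).
Proof.
move=> wp; have bilin k k' l l' c := @w_point_bilin R w alpha beta k k' l l' c wp.
have x2 l : coord alpha (pscale 2 l) w = 2 * coord alpha l w.
  by rewrite /coord fr_scale mulrCA.
have xB k l : coord alpha (psub k l) w = coord alpha k w - coord alpha l w.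
  by rewrite /coord fr_sub mulrBr.
have yB k l : coord beta (psub k l) w = coord beta k w - coord beta l w.
  by rewrite /coord fr_sub mulrBr.
move: (coord alpha) (coord beta) bilin x2 xB yB => x y bilin x2 xB yB.
split; unfold sqdist; cbn [fst snd].
- have /bilin : bilin_check w_poly den
      num_t num_t
      den den (Z.of_nat 12).
    by vm_compute.
  by rewrite ?(xB, yB, x2) => h; clear -h; lra.
- have /bilin : bilin_check w_poly den
      num_t (psub (pscale 2 num_t) num_xD)
      den num_yD (Z.of_nat 18).
    by vm_compute.
  by rewrite ?(xB, yB, x2) => h; clear -h; lra.
- have /bilin : bilin_check w_poly den
      (psub num_xD (pscale 2 num_t)) (psub num_xD (pscale 2 num_t))
      num_yD num_yD (Z.of_nat 108).
    by vm_compute.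
  by rewrite ?(xB, yB, x2) => h; clear -h; lra.
- have /bilin : bilin_check w_poly den
      num_t (psub num_t den)
      den (psub num_yE den) (Z.of_nat 12).
    by vm_compute.
  by rewrite ?(xB, yB, x2) => h; clear -h; lra.
- have /bilin : bilin_check w_poly den
      (psub den num_t) (psub den num_t)
      (psub num_yE den) (psub num_yE den) (Z.of_nat 48).
    by vm_compute.
  by rewrite ?(xB, yB, x2) => h; clear -h; lra.
- have /bilin : bilin_check w_poly den
      num_xF num_xF
      num_yF num_yF (Z.of_nat 12).
    by vm_compute.
  by rewrite ?(xB, yB, x2) => h; clear -h; lra.
- have /bilin : bilin_check w_poly den
      (psub den num_xF) (psub den num_xF)
      (psub num_yE num_yF) (psub num_yE num_yF) (Z.of_nat 12).
    by vm_compute.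
  by rewrite ?(xB, yB, x2) => h; clear -h; lra.
- have /bilin : bilin_check w_poly den
      (psub num_xF num_xG) (psub num_xF num_xG)
      (psub num_yF num_yG) (psub num_yF num_yG) (Z.of_nat 12).
    by vm_compute.
  by rewrite ?(xB, yB, x2) => h; clear -h; lra.
- have /bilin : bilin_check w_poly den
      (psub num_xD num_xG) (psub num_xD num_xG)
      (psub num_yD num_yG) (psub num_yD num_yG) (Z.of_nat 48).
    by vm_compute.
  by rewrite ?(xB, yB, x2) => h; clear -h; lra.
- have /bilin : bilin_check w_poly den
      (psub num_xD num_xH) (psub num_xD num_xH)
      (psub num_yD num_yH) (psub num_yD num_yH) (Z.of_nat 48).
    by vm_compute.
  by rewrite ?(xB, yB, x2) => h; clear -h; lra.
- have /bilin : bilin_check w_poly den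
      (psub num_xG num_xH) (psub num_xG num_xH)
      (psub num_yG num_yH) (psub num_yG num_yH) (Z.of_nat 48).
    by vm_compute.
  by rewrite ?(xB, yB, x2) => h; clear -h; lra.
- have /bilin : bilin_check w_poly den
      (psub num_xF num_xH) (psub num_xF num_xH)
      (psub num_yF num_yJ) (psub num_yF num_yJ) (Z.of_nat 12).
    by vm_compute.
  by rewrite ?(xB, yB, x2) => h; clear -h; lra.
- have /bilin : bilin_check w_poly den
      (psub num_xG num_xH) (psub num_xG num_xH)
      (psub num_yG num_yJ) (psub num_yG num_yJ) (Z.of_nat 12).
    by vm_compute.
  by rewrite ?(xB, yB, x2) => h; clear -h; lra.
- by [].
Qed.

Lemma w_point_near (R : realType) (w alpha beta : R) : w_point w alpha beta ->
  harborth_near (coord alpha num_t w) (coord beta den w)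
    (coord alpha num_xD w, coord beta num_yD w)
    (coord alpha den w, coord beta num_yE w)
    (coord alpha num_xF w, coord beta num_yF w)
    (coord alpha num_xG w, coord beta num_yG w)
    (coord alpha num_xH w, coord beta num_yH w)
    (coord alpha num_xH w, coord beta num_yJ w).
Proof.
case=> _ den_gt0 w_near _ _ alpha_near beta_near.
have near_den_ge0 : Z.le Z0 near_den by [].
have near_coord ca (l : seq Z) (c : Z) (a : R) :
    `|zr R sqrt_den * a - zr R ca| <= 1 ->
    coord_check w_num w_den sqrt_den near_den ca den l c ->
    near1 (coord a l w) (zr R c).
  move=> a_near l_c; apply: near1_zr.
  exact: coord_checkP w_den_gt0 sqrt_den_gt0 near_den_ge0 w_near den_gt0 a_near l_c.
have near_x l c := @near_coord alpha_num l c alpha alpha_near.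
have near_y l c := @near_coord beta_num l c beta beta_near.
clear -near_x near_y; move: (coord alpha) (coord beta) near_x near_y => x y near_x near_y.
split; cbn [fst snd].
- have /near_x : coord_check w_num w_den sqrt_den near_den alpha_num den
      num_t 99269 by vm_compute.
  by generalize_numerals.
- have /near_y : coord_check w_num w_den sqrt_den near_den beta_num den
      den 12073 by vm_compute.
  by generalize_numerals.
- have /near_x : coord_check w_num w_den sqrt_den near_den alpha_num den
      num_xD 81000 by vm_compute.
  by generalize_numerals.
- have /near_y : coord_check w_num w_den sqrt_den near_den beta_num den
      num_yD 276016 by vm_compute.
  by generalize_numerals.
- have /near_x : coord_check w_num w_den sqrt_den near_den alpha_num den
      den 20910 by vm_compute.
  by generalize_numerals.
- have /near_y : coord_check w_num w_den sqrt_den near_den beta_num den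
      num_yE 196083 by vm_compute.
  by generalize_numerals.
- have /near_x : coord_check w_num w_den sqrt_den near_den alpha_num den
      num_xF (-6140) by vm_compute.
  by generalize_numerals.
- have /near_y : coord_check w_num w_den sqrt_den near_den beta_num den
      num_yF 99811 by vm_compute.
  by generalize_numerals.
- have /near_x : coord_check w_num w_den sqrt_den near_den alpha_num den
      num_xG (-83842) by vm_compute.
  by generalize_numerals.
- have /near_y : coord_check w_num w_den sqrt_den near_den beta_num den
      num_yG 162759 by vm_compute.
  by generalize_numerals.
- have /near_x : coord_check w_num w_den sqrt_den near_den alpha_num den
      num_xH (-99505) by vm_compute.
  by generalize_numerals.
- have /near_y : coord_check w_num w_den sqrt_den near_den beta_num den
      num_yH 362144 by vm_compute.
  by generalize_numerals.
- have /near_x : coord_check w_num w_den sqrt_den near_den alpha_num den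
      num_xH (-99505) by vm_compute.
  by generalize_numerals.
- have /near_y : coord_check w_num w_den sqrt_den near_den beta_num den
      num_yJ 63993 by vm_compute.
  by generalize_numerals.
Qed.

Lemma w_point_roots (R : realType) (w alpha beta : R) : w_point w alpha beta ->
  [/\ root (map_poly ratr P_yG) (coord beta num_yG w),
      root (map_poly ratr P_yH) (coord beta num_yH w) &
      root (map_poly ratr P_yJ) (coord beta num_yJ w)].
Proof.
case=> w_root den_gt0 _ _ beta_w _ _; split.
(* [k] is 2^7 * 6517^3, and 2^8 * 6517^3 in the other two cases, where 6517 is the odd part of the
   leading coefficient of [w_poly]; over this denominator the numerators of the powers are
   integral. *)
- apply: (root_checkP (U := sq_yG) (k := 35428529972864)
            (U2 := pow4_yG) (U3 := pow6_yG) (U4 := pow8_yG)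
            P_yG_list w_root den_gt0 beta_w); first by [].
  by vm_compute.
- apply: (root_checkP (U := sq_yH) (k := 70857059945728)
            (U2 := pow4_yH) (U3 := pow6_yH) (U4 := pow8_yH)
            P_yH_list w_root den_gt0 beta_w); first by [].
  by vm_compute.
- apply: (root_checkP (U := sq_yJ) (k := 70857059945728)
            (U2 := pow4_yJ) (U3 := pow6_yJ) (U4 := pow8_yJ)
            P_yJ_list w_root den_gt0 beta_w); first by [].
  by vm_compute.
Qed.

Lemma minimal_poly_of_root (R : realType) (p : {poly rat}) (y : R) :
    irreducible_poly p -> root (map_poly ratr p) y ->
  algebraicOver ratr y /\ minimal_poly_over_Q p y.
Proof. by move=> p_irr py; split=> //; exists p => //; apply: irredp_neq0. Qed.

Theorem mainTheorem7 (R : realType) (t T : R) (D E F G H J : R * R)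
    (hsys : harborth_system t T D E F G H J)
    (happrox : harborth_approx t T D E F G H J) :
  [/\ algebraicOver ratr G.2 /\ minimal_poly_over_Q P_yG G.2,
      algebraicOver ratr H.2 /\ minimal_poly_over_Q P_yH H.2 &
      algebraicOver ratr J.2 /\ minimal_poly_over_Q P_yJ J.2].
Proof.
have [w [alpha [beta wp]]] := w_point_exists R.
(* Rigidity identifies the given G, H and J with those of the exact configuration. *)
have [-> -> ->] := harborth_rigid hsys (harborth_approx_near happrox)
                     (w_point_system wp) (w_point_near wp).
have [rootG rootH rootJ] := w_point_roots wp.
split.
- exact: minimal_poly_of_root P_yG_irreducible rootG.
- exact: minimal_poly_of_root P_yH_irreducible rootH.
- exact: minimal_poly_of_root P_yJ_irreducible rootJ.
Qed.
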